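(* Let $X_1,\dots,X_n$ be the independent lifetimes of $n$ testing units, with common density $f(\cdot;\theta)$ and distribution function $F(\cdot;\theta)$, where $\theta$ is an unknown one-dimensional parameter. Let $l,r\in\{1,\dots,n\}$ with $l<r$, and let $T_1,T_2\in(0,\infty)$ with $T_1<T_2$. Then the Fisher information $I(\theta)$ about $\theta$ under the Type-II unified hybrid censoring scheme with design parameters $(n,r,l,T_1,T_2)$ is given by $$I(\theta)=I_{1,\ldots,l:n}(\theta)+I_{T_1}(\theta)+I_{X_{r:n}\wedge T_2}(\theta)-I_{X_{l:n}\wedge T_2}(\theta)-I_{X_{r:n}\wedge T_1}(\theta),$$ where $I_{1,\ldots,l:n}(\theta)$ is the Fisher information about $\theta$ in the Type-II censored data with pre-specified number of failures $l$, $I_{T_1}(\theta)$ is the Fisher information about $\theta$ in the Type-I censored data with censoring time $T_1$, and $I_{X_{r:n}\wedge T_2}(\theta)$, $I_{X_{l:n}\wedge T_2}(\theta)$, $I_{X_{r:n}\wedge T_1}(\theta)$ are the Fisher informations about $\theta$ in the data from the Type-I hybrid censoring schemes $(r,T_2)$, $(l,T_2)$ and $(r,T_1)$, respectively.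
   Context: Notation: $X_{1:n}<X_{2:n}<\cdots<X_{n:n}$ are the ordered lifetimes; $x\wedge y=\min(x,y)$ and $x\vee y=\max(x,y)$. Each scheme puts $n$ units on test at time $0$ and observes the failures up to a termination time $\eta$. With $D$ the number of failures observed up to $\eta$, the data are $(X_{1:n},\dots,X_{D:n},\eta)$, and the likelihood is proportional to $L(\theta)=\prod_{i=1}^{D}f(X_{i:n};\theta)\,(1-F(\eta;\theta))^{n-D}$. The Fisher information about $\theta$ in the data is, as usual, the expectation of the square of the score $\frac{\partial}{\partial\theta}\ln L(\theta)$. The schemes: - Type-II censoring with $l$ failures: $\eta=X_{l:n}$. - Type-I censoring with censoring time $T$: $\eta=T$. - Type-I hybrid censoring scheme $(k,T)$: $\eta=X_{k:n}\wedge T$. - Type-II unified hybrid censoring scheme $(n,r,l,T_1,T_2)$: $\eta=\xi=(X_{l:n}\vee T_2)\wedge(X_{r:n}\vee T_1)$. That is, the test stops at $T_1$ if $X_{l:n}<X_{r:n}<T_1<T_2$; at $X_{r:n}$ if $X_{l:n}<T_1<X_{r:n}<T_2$ or $T_1<X_{l:n}<X_{r:n}<T_2$; at $T_2$ if $X_{l:n}<T_1<T_2<X_{r:n}$ or $T_1<X_{l:n}<T_2<X_{r:n}$; and at $X_{l:n}$ if $T_1<T_2<X_{l:n}<X_{r:n}$. *)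

(* Defs.v *)
From HB Require Import structures.
From mathcomp Require Import all_boot all_order all_algebra.
From mathcomp Require Import all_classical all_reals all_analysis.
Import Order.TTheory GRing.Theory Num.Theory.
Import numFieldNormedType.Exports.
Set Implicit Arguments.
Unset Strict Implicit.
Unset Printing Implicit Defensive.
Local Open Scope classical_set_scope.
Local Open Scope ring_scope.

Definition lifetime_density (R : realType) (g : R -> R) : Prop :=
  [/\ measurable_fun setT g,
      forall x, 0 <= g x,
      forall x, x < 0 -> g x = 0 &
      (\int[lebesgue_measure]_(x in setT) (g x)%:E = 1)%E].

Definition cdf_of (R : realType) (g : R -> R) (t : R) : R :=
  fine (\int[lebesgue_measure]_(x in `]-oo, t]) (g x)%:E)%E.

Definition has_density d (T : measurableType d) (R : realType)
    (P : probability T R) (X : {RV P >-> R}) (g : R -> R) : Prop :=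
  forall A : set R, measurable A ->
    distribution P X A = (\int[lebesgue_measure]_(x in A) (g x)%:E)%E.

Definition mutually_independent d (T : measurableType d) (R : realType)
    (P : probability T R) (n : nat) (X : 'I_n -> {mfun T >-> R}) : Prop :=
  forall (J : {set 'I_n}) (A : 'I_n -> set R), (forall i, measurable (A i)) ->
    P [set w | forall i, i \in J -> A i (X i w)] =
    (\prod_(i in J) P (X i @^-1` A i))%E.

(* [P theta] is the law under the parameter value [theta]; the random variables
   themselves do not depend on [theta]. *)
Definition iid_lifetimes d (T : measurableType d) (R : realType)
    (Theta : set R) (P : R -> probability T R) (f : R -> R -> R)
    (n : nat) (X : 'I_n -> {mfun T >-> R}) : Prop :=
  forall theta, Theta theta ->
    [/\ lifetime_density (f theta),
        forall i, has_density (P := P theta) (X i) (f theta) &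
        mutually_independent (P theta) X].

Section Schemes.
Context d (T : measurableType d) (R : realType) (n : nat).
Variable X : 'I_n -> {mfun T >-> R}.

(* The order statistics are numbered from 1: [order_stat k] is X_{k:n} for
   1 <= k <= n. *)
Definition order_stat (k : nat) (w : T) : R :=
  nth 0 (sort <=%O [seq X i w | i <- enum 'I_n]) k.-1.

(* The termination time of each scheme. *)
Definition type2_time (l : nat) : T -> R := order_stat l.

Definition type1_time (t : R) : T -> R := fun=> t.

Definition hybrid_time (k : nat) (t : R) : T -> R :=
  fun w => Num.min (order_stat k w) t.

Definition unified_hybrid_time (r l : nat) (t1 t2 : R) : T -> R :=
  fun w => Num.min (Num.max (order_stat l w) t2) (Num.max (order_stat r w) t1).

Definition nb_failures (eta : T -> R) (w : T) : nat :=
  #|[set i : 'I_n | X i w <= eta w]%SET|.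

Definition likelihood (f : R -> R -> R) (eta : T -> R) (w : T) (theta : R) : R :=
  (\prod_(1 <= i < (nb_failures eta w).+1) f theta (order_stat i w)) *
  (1 - cdf_of (f theta) (eta w)) ^+ (n - nb_failures eta w).

Definition log_likelihood (f : R -> R -> R) (eta : T -> R) (w : T) (theta : R) : R :=
  ln (likelihood f eta w theta).

Definition score (f : R -> R -> R) (eta : T -> R) (theta : R) (w : T) : R :=
  derive1 (log_likelihood f eta w) theta.

(* [derive1] is a total operator: the score is meaningful only where the
   log-likelihood is differentiable in the parameter. *)
Definition score_exists (P : R -> probability T R) (f : R -> R -> R)
    (eta : T -> R) (theta : R) : Prop :=
  {ae P theta, forall w, derivable (log_likelihood f eta w) theta 1}.

Definition fisher_info (P : R -> probability T R) (f : R -> R -> R)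
    (eta : T -> R) (theta : R) : \bar R :=
  ('E_(P theta)[fun w => (score f eta theta w ^+ 2)%R])%E.

End Schemes.

(* Main.v *)
(* The score at an outcome depends on the scheme only through the value of the
   termination time there.  If a <= b are the two order statistics and t1 < t2,
   the multisets
     {(a \/ t2) /\ (b \/ t1), a /\ t2, b /\ t1}  and  {a, t1, b /\ t2}
   coincide, so the squared scores of the six schemes satisfy a pointwise
   identity, and the theorem follows by integrating it.  Additivity of the
   integral needs measurability of the scores: off a null set each one is the
   limit of the difference quotients of the log-likelihood along 1/n, and the
   log-likelihood at a fixed parameter is measurable in the outcome. *)
Require Import Defs.
From HB Require Import structures.
From mathcomp Require Import all_boot all_order all_algebra.
From mathcomp Require Import all_classical all_reals all_analysis.
From mathcomp Require Import measurable_realfun.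
Import Order.TTheory GRing.Theory Num.Theory.
Import numFieldNormedType.Exports.
Import HBNNSimple.
Local Open Scope classical_set_scope.
Local Open Scope ring_scope.

(* The integral of a nonnegative function, measurable or not, is a supremum over
   the simple functions below it, and those may be cut off on a null set. *)
Lemma ge0_integral_setC_null {d} {T : measurableType d} {R : realType}
    (mu : {measure set T -> \bar R}) (N : set T) (g : T -> \bar R) :
  measurable N -> mu N = 0%E -> (forall x, (0 <= g x)%E) ->
  (\int[mu]_x g x = \int[mu]_(x in ~` N) g x)%E.
Proof.
move=> mN N0 g0; rewrite ge0_integralTE// ge0_integralE//.
apply/eqP; rewrite eq_le; apply/andP; split; apply: ge_ereal_sup => /=.
- move=> _ [h /= hg <-]; apply: ereal_sup_ubound => /=.
  exists (proj_nnsfun h (measurableC mN)); rewrite -mrestrict.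
    by move=> x; rewrite !patchE; case: ifP.
  rewrite -integralT_nnsfun (ge0_negligible_integral mN)//.
  - by rewrite setTD integral_nnsfun//; exact: measurableC.
  - by apply/measurable_EFinP.
  - by move=> x _; rewrite lee_fin; exact: fun_ge0.
- move=> _ [h /= hg <-]; apply: ereal_sup_ubound => /=.
  exists h => // x; apply: (le_trans (hg x)); rewrite patchE.
  by case: ifP.
Qed.

Lemma eq_adde2_subl {R : realType} (u x y z : \bar R) :
  y \is a fin_num -> z \is a fin_num ->
  (u + y + z = x -> u = x - y - z)%E.
Proof. by move=> y_fin z_fin <-; rewrite (addeAC u) addeK// addeK. Qed.

Lemma ge0_integral_EFinD3 {d} {T : measurableType d} {R : realType}
    (mu : {measure set T -> \bar R}) (D : set T) (g1 g2 g3 : T -> R) :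
  measurable D -> measurable_fun D g1 -> measurable_fun D g2 ->
  measurable_fun D g3 -> (forall x, 0 <= g1 x) -> (forall x, 0 <= g2 x) ->
  (forall x, 0 <= g3 x) ->
  (\int[mu]_(x in D) (g1 x + g2 x + g3 x)%:E =
   \int[mu]_(x in D) (g1 x)%:E + \int[mu]_(x in D) (g2 x)%:E
   + \int[mu]_(x in D) (g3 x)%:E)%E.
Proof.
move=> mD m1 m2 m3 g1_ge0 g2_ge0 g3_ge0.
under eq_integral do rewrite EFinD.
rewrite ge0_integralD//; last 4 first.
- by move=> x _; rewrite lee_fin addr_ge0.
- by apply/measurable_EFinP; exact: measurable_funD.
- by move=> x _; rewrite lee_fin.
- exact/measurable_EFinP.
congr (_ + _)%E; under eq_integral do rewrite EFinD.
by rewrite ge0_integralD//; [move=> x _; rewrite lee_fin|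
  exact/measurable_EFinP|move=> x _; rewrite lee_fin|exact/measurable_EFinP].
Qed.

(** The likelihood has a random number of factors, for which measurability of finite products does
    not apply directly. It becomes a product over the fixed range 1 to [n] whose [i]-th factor is
    [F i w] when [i <= D w] and [G w] otherwise; the power of [G w] supplies exactly the [n - D w]
    remaining factors. *)
Lemma measurable_fun_prod_bounded {d} {T : measurableType d} {R : realType}
    (D : T -> nat) (n : nat) (F : nat -> T -> R) (G : T -> R) :
  (forall w, D w <= n)%N ->
  (forall i, (0 < i <= n)%N -> measurable_fun setT (fun w => (i <= D w)%N)) ->
  (forall i, (0 < i <= n)%N -> measurable_fun setT (F i)) ->
  measurable_fun setT G ->
  measurable_fun setT
    (fun w => \prod_(1 <= i < (D w).+1) F i w * G w ^+ (n - D w)).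
Proof.
move=> Dn mD mF mG.
rewrite (_ : (fun w => _) =
  fun w => \prod_(i <- index_iota 1 n.+1)
             (if (i <= D w)%N then F i w else G w)).
  apply: measurable_prod => i; rewrite mem_index_iota ltnS => i_n.
  by apply: measurable_fun_ifT; [exact: mD|exact: mF|exact: mG].
apply/funext => w; rewrite [RHS](@big_cat_nat _ _ _ (D w).+1) ?ltnS//=.
congr (_ * _).
  by apply: eq_big_nat => i /andP[_]; rewrite ltnS => ->.
rewrite (@eq_big_nat _ _ _ (D w).+1 _ _ (fun=> G w)); last first.
  by move=> i /andP[Di _]; rewrite leqNgt Di.
by rewrite prodr_const_nat subSS.
Qed.

Lemma cdf_of_nondecreasing {R : realType} (g : R -> R) :
  lifetime_density g -> nondecreasing_fun (cdf_of g).
Proof.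
move=> [mg g0 _ g1] s t st; rewrite /cdf_of.
have mgE : measurable_fun setT (EFin \o g) by apply/measurable_EFinP.
have le1 (A B : set R) : measurable A -> measurable B -> A `<=` B ->
    (\int[lebesgue_measure]_(x in A) (g x)%:E <=
     \int[lebesgue_measure]_(x in B) (g x)%:E)%E.
  move=> mA mB AB; apply: ge0_subset_integral => //.
    by apply: measurable_funTS.
  by move=> x _; rewrite lee_fin.
(* [fine] sends infinite values to 0, so it preserves the order only between finite integrals; the
   total mass 1 provides the bound. *)
have fin u : (\int[lebesgue_measure]_(x in `]-oo, u]) (g x)%:E)%E \is a fin_num.
  rewrite ge0_fin_numE; last by apply: integral_ge0 => x _; rewrite lee_fin.
  by rewrite (@le_lt_trans _ _ 1%E)// ?ltry// -g1; exact: le1.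
apply: fine_le => //; apply: le1 => // x /=; rewrite !in_itv/= => xs.
exact: le_trans st.
Qed.

(** An arbitrary [phi] into a commutative monoid encodes equality of multisets. Three cases suffice:
    [b <= t1]; [t1 < b] with [a <= t2]; and [t2 < a]. In each of them the sums agree up to the order
    of their terms. *)
Lemma hybrid_multiset_identity {R : realType} (V : nmodType) (phi : R -> V)
    (a b t1 t2 : R) : a <= b -> t1 < t2 ->
  phi (Num.min (Num.max a t2) (Num.max b t1)) + phi (Num.min a t2)
    + phi (Num.min b t1) =
  phi a + phi t1 + phi (Num.min b t2).
Proof.
move=> ab t12; have t12' := ltW t12.
have [bt1|t1b] := leP b t1.
  have at1 := le_trans ab bt1.
  have at2 := le_trans at1 t12'; have bt2 := le_trans bt1 t12'.
  rewrite (max_r at2) (min_r t12') (min_l at2) (min_l bt2).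
  by rewrite (addrC (phi t1)).
have [at2|t2a] := leP a t2.
  by rewrite (minC t2) -addrA [RHS]addrC.
by rewrite (min_l ab) (min_r (le_trans (ltW t2a) ab)) addrAC.
Qed.

Section order_statistics.
Context d (T : measurableType d) (R : realType) (n : nat).
Variable X : 'I_n -> {mfun T >-> R}.

(** Sorting permutes the sample, so the cardinal counts the entries of the sorted list that are at
    most [x], and these form an initial segment; ties do no harm. This turns questions about sorting
    into questions about counting. *)
Lemma order_stat_le (k : nat) (w : T) (x : R) : (0 < k <= n)%N ->
  (order_stat X k w <= x) = (k <= #|[set i : 'I_n | (X i w <= x)%R]%SET|)%N.
Proof.
case: k => // k /= kn; rewrite /order_stat.
set s := sort _ _.
have ss : sorted <=%O s by exact/sort_sorted/le_total.
have size_s : size s = n by rewrite size_sort size_map size_enum_ord.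
have -> : #|[set i : 'I_n | (X i w <= x)%R]%SET| = count (<= x) s.
  by rewrite count_sort count_map cardsE cardE enumT -size_filter.
apply/idP/idP => [|ks]; last exact: nth_count_le.
apply: contraTT; rewrite -leqNgt -ltNge => ks.
by apply: nth_count_gt; rewrite ?size_s ?ks.
Qed.

Lemma order_stat_homo (k m : nat) (w : T) : (0 < k)%N -> (k <= m)%N ->
  (m <= n)%N -> order_stat X k w <= order_stat X m w.
Proof.
move=> k0 km mn; rewrite order_stat_le ?k0 /=; last exact: leq_trans mn.
by apply: (leq_trans km); rewrite -order_stat_le// mn (leq_trans k0).
Qed.

Lemma measurable_order_stat (k : nat) : (0 < k <= n)%N ->
  measurable_fun setT (order_stat X k).
Proof.
move=> kn.
apply: (measurability (@RGenOInfty.G R)) => [|/= _ [_] [x] -> <-].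
  exact: RGenOInfty.measurableE.
(* The preimage of the ray above [x] is the event that fewer than [k] lifetimes are at most [x]. The
   count is written as a real sum of indicators, so that measurability of sums and of comparisons
   applies. *)
rewrite setTI (_ : _ @^-1` _ =
    ~` [set w | k%:R <= \sum_(i < n) (if X i w <= x then 1 else 0 : R)]).
  apply: measurableC; rewrite -[X in measurable X]setTI.
  apply: measurable_fun_le => //; apply: measurable_sum => i.
  by apply: measurable_fun_ifT => //; exact: measurable_fun_ler.
apply/seteqP; split => w /=;
  by rewrite in_itv/= andbT ltNge order_stat_le// -(ler_nat R) -sum1dep_card
             natr_sum -big_mkcond => /negP.
Qed.

Lemma measurable_likelihood (f : R -> R -> R) (eta : T -> R) (theta : R) :
  lifetime_density (f theta) -> measurable_fun setT eta ->
  measurable_fun setT (fun w => likelihood X f eta w theta).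
Proof.
move=> fd meta; have mf : measurable_fun setT (f theta) by case: fd.
apply: (@measurable_fun_prod_bounded _ _ _ (nb_failures X eta) n
  (fun i w => f theta (order_stat X i w))
  (fun w => 1 - cdf_of (f theta) (eta w))).
- by move=> w; rewrite (leq_trans (max_card _))// card_ord.
(* The [i]-th factor is present exactly when the [i]-th failure occurs by time [eta w], which is a
   comparison of two measurable functions. *)
- move=> i i_n; under eq_fun do rewrite /nb_failures -order_stat_le//.
  by apply: measurable_fun_ler => //; exact: measurable_order_stat.
- by move=> i i_n; apply: measurableT_comp => //; exact: measurable_order_stat.
- apply: measurable_funB => //; apply: measurableT_comp => //.
  by apply: nondecreasing_measurable => //; exact: cdf_of_nondecreasing.
Qed.

Lemma measurable_score (Theta : set R) (f : R -> R -> R) (eta : T -> R)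
    (theta : R) (G : set T) :
  open Theta -> Theta theta -> (forall t, Theta t -> lifetime_density (f t)) ->
  measurable_fun setT eta ->
  (forall w, G w -> derivable (log_likelihood X f eta w) theta 1) ->
  measurable_fun G (score X f eta theta).
Proof.
move=> Topen Ttheta fd meta dG.
have [e /= e0 eTheta] : nbhs_ball theta Theta.
  by apply/nbhs_ballP; exact: open_nbhs_nbhs.
(* The factor [e / 2] keeps every shifted parameter [u m + theta] inside the ball of radius [e],
   hence in [Theta], where [f] is known to be a density and the likelihood is measurable. *)
pose u (m : nat) := e / 2 * harmonic m : R.
have u0 m : 0 < u m by rewrite mulr_gt0 ?divr_gt0 ?harmonic_gt0.
have uTheta m : Theta (u m + theta).
  apply: eTheta; rewrite /ball/= distrC addrK gtr0_norm//.
  rewrite (@le_lt_trans _ _ (e / 2))//; last first.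
    by rewrite ltr_pdivrMr// ltr_pMr// ltr1n.
  by rewrite ler_piMr ?divr_ge0 ?(ltW e0)// invf_le1// ler1n.
have ucvg : u @ \oo --> (0 : R).
  by rewrite -(mulr0 (e / 2)); apply: cvgMl_tmp; exact: cvg_harmonic.
pose q h w := h^-1 *: (log_likelihood X f eta w (h + theta)
                       - log_likelihood X f eta w theta) : R.
apply: (@measurable_fun_cvg _ _ _ _ (fun m => q (u m))) => [m|w Gw].
  apply: measurable_funTS; apply: measurable_funM => //.
  by apply: measurable_funB; apply: measurableT_comp => //;
    apply: measurable_likelihood => //; exact: fd.
(* Derivability gives convergence of the quotients on the punctured neighbourhood of 0; the positive
   sequence [u] then inherits the limit. *)
have /cvgr_dnbhsP : q h w @[h --> 0^'] --> score X f eta theta w.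
  have := dG _ Gw; rewrite /derivable /score /derive1.
  by under eq_fun do rewrite /= /GRing.scale/= mulr1.
by apply; split=> // m; rewrite gt_eqF.
Qed.

End order_statistics.

Lemma fisher_info_setC_null {d} {T : measurableType d} {R : realType} {n : nat}
    (X : 'I_n -> {mfun T >-> R}) (P : R -> probability T R) (f : R -> R -> R)
    (eta : T -> R) (theta : R) (N : set T) :
  measurable N -> P theta N = 0%E ->
  (fisher_info X P f eta theta =
   \int[P theta]_(w in ~` N) (score X f eta theta w ^+ 2)%:E)%E.
Proof.
move=> mN N0; rewrite /fisher_info unlock.
by apply: ge0_integral_setC_null => // w; rewrite lee_fin sqr_ge0.
Qed.

Theorem theorem5 (R : realType) (d : measure_display) (T : measurableType d)
    (Theta : set R) (P : R -> probability T R) (f : R -> R -> R)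
    (n : nat) (X : 'I_n -> {mfun T >-> R})
    (l r : nat) (T1 T2 : R) (theta : R)
    (Theta_open : open Theta)
    (X_iid : iid_lifetimes Theta P f X)
    (l_gt0 : (0 < l)%N) (l_lt_r : (l < r)%N) (r_le_n : (r <= n)%N)
    (T1_gt0 : 0 < T1) (T1_lt_T2 : T1 < T2)
    (theta_in : Theta theta)
    (score_l : score_exists X P f (type2_time X l) theta)
    (score_T1 : score_exists X P f (type1_time T1) theta)
    (score_rT2 : score_exists X P f (hybrid_time X r T2) theta)
    (score_lT2 : score_exists X P f (hybrid_time X l T2) theta)
    (score_rT1 : score_exists X P f (hybrid_time X r T1) theta)
    (fin_lT2 : (fisher_info X P f (hybrid_time X l T2) theta < +oo)%E)
    (fin_rT1 : (fisher_info X P f (hybrid_time X r T1) theta < +oo)%E) :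
  fisher_info X P f (unified_hybrid_time X r l T1 T2) theta =
  (fisher_info X P f (type2_time X l) theta
   + fisher_info X P f (type1_time T1) theta
   + fisher_info X P f (hybrid_time X r T2) theta
   - fisher_info X P f (hybrid_time X l T2) theta
   - fisher_info X P f (hybrid_time X r T1) theta)%E.
Proof.
have l_n : (0 < l <= n)%N by rewrite l_gt0 (leq_trans (ltnW l_lt_r)).
have r_n : (0 < r <= n)%N by rewrite r_le_n (leq_trans l_gt0 (ltnW l_lt_r)).
have fd t : Theta t -> lifetime_density (f t) by move=> /X_iid[].
(* A single null set [N] is taken, off which the five scores on the right-hand side all exist. *)
have [N [mN N0 subN]] := filterI score_l (filterI score_T1
  (filterI score_rT2 (filterI score_lT2 score_rT1))).
have {}subN w : (~` N) w ->
    [/\ derivable (log_likelihood X f (type2_time X l) w) theta 1,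
        derivable (log_likelihood X f (type1_time T1) w) theta 1,
        derivable (log_likelihood X f (hybrid_time X r T2) w) theta 1,
        derivable (log_likelihood X f (hybrid_time X l T2) w) theta 1 &
        derivable (log_likelihood X f (hybrid_time X r T1) w) theta 1].
  by move=> /(subsetC subN); rewrite setCK => -[? [? [? []]]].
pose s2 eta w := score X f eta theta w ^+ 2.
have ms2 eta : measurable_fun setT eta ->
    (forall w, (~` N) w -> derivable (log_likelihood X f eta w) theta 1) ->
    measurable_fun (~` N) (s2 eta).
  by move=> meta deta; apply: measurable_funX;
    exact: (@measurable_score _ _ _ _ X Theta).
have ml := @measurable_order_stat _ _ _ _ X _ l_n.
have mr := @measurable_order_stat _ _ _ _ X _ r_n.
have m_l : measurable_fun (~` N) (s2 (type2_time X l)).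
  by apply: ms2 => // w /subN[].
have m_T1 : measurable_fun (~` N) (s2 (type1_time T1)).
  by apply: ms2 => [|w /subN[]//]; exact: measurable_cst.
have m_rT2 : measurable_fun (~` N) (s2 (hybrid_time X r T2)).
  by apply: ms2 => [|w /subN[]//]; exact: measurable_minr.
have m_lT2 : measurable_fun (~` N) (s2 (hybrid_time X l T2)).
  by apply: ms2 => [|w /subN[]//]; exact: measurable_minr.
have m_rT1 : measurable_fun (~` N) (s2 (hybrid_time X r T1)).
  by apply: ms2 => [|w /subN[]//]; exact: measurable_minr.
(* At a fixed outcome the score sees [eta] only through the number [eta w], so each termination time
   may be replaced by a constant one. This makes the squared score a function [phi] of that number,
   and the identity holds at every outcome. *)
have s2E w : s2 (unified_hybrid_time X r l T1 T2) w + s2 (hybrid_time X l T2) w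
      + s2 (hybrid_time X r T1) w =
    s2 (type2_time X l) w + s2 (type1_time T1) w + s2 (hybrid_time X r T2) w.
  by apply: (@hybrid_multiset_identity _ R (fun c => s2 (fun=> c) w)) => //;
    apply: order_stat_homo => //; exact: ltnW.
(* Measurability for the unified scheme is read off the pointwise identity, which expresses its
   squared score through the five others. *)
have m_u : measurable_fun (~` N) (s2 (unified_hybrid_time X r l T1 T2)).
  rewrite (_ : s2 _ = fun w => s2 (type2_time X l) w + s2 (type1_time T1) w
      + s2 (hybrid_time X r T2) w - s2 (hybrid_time X r T1) w
      - s2 (hybrid_time X l T2) w).
    by do 2 (apply: measurable_funB => //); do 2 (apply: measurable_funD => //).
  have subE (x u y z : R) : u + y + z = x -> u = x - z - y.
    by move=> <-; rewrite !addrK.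
  by apply/funext => w; exact: subE (s2E w).
have mNC := measurableC mN.
have intD3 eta1 eta2 eta3 : measurable_fun (~` N) (s2 eta1) ->
    measurable_fun (~` N) (s2 eta2) -> measurable_fun (~` N) (s2 eta3) ->
    (fisher_info X P f eta1 theta + fisher_info X P f eta2 theta
     + fisher_info X P f eta3 theta =
     \int[P theta]_(w in ~` N) (s2 eta1 w + s2 eta2 w + s2 eta3 w)%:E)%E.
  move=> m1 m2 m3; rewrite !(fisher_info_setC_null X P f _ theta N)//.
  by apply/esym/ge0_integral_EFinD3 => // w; rewrite sqr_ge0.
have fin eta : (fisher_info X P f eta theta < +oo)%E ->
    fisher_info X P f eta theta \is a fin_num.
  rewrite (fisher_info_setC_null X P f _ theta N)// => lty.
  by rewrite ge0_fin_numE// integral_ge0// => w _; rewrite lee_fin sqr_ge0.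
(* The identity is integrated in its additive form, where all terms are nonnegative and infinite
   values are harmless. The two finite informations are moved across only afterwards. *)
have sumE : (fisher_info X P f (unified_hybrid_time X r l T1 T2) theta
     + fisher_info X P f (hybrid_time X l T2) theta
     + fisher_info X P f (hybrid_time X r T1) theta =
   fisher_info X P f (type2_time X l) theta
     + fisher_info X P f (type1_time T1) theta
     + fisher_info X P f (hybrid_time X r T2) theta)%E.
  apply: etrans (intD3 _ _ _ m_u m_lT2 m_rT1) _.
  apply: etrans _ (esym (intD3 _ _ _ m_l m_T1 m_rT2)).
  by apply: eq_integral => w _; exact: congr1 (s2E w).
exact: eq_adde2_subl (fin _ fin_lT2) (fin _ fin_rT1) sumE.
Qed.
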